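(* Let $r=s$, let $c_1,\dots,c_s\in[0,1]$ be distinct, let $\bar l_1,\dots,\bar l_s$ be the degree-$(s-1)$ Lagrange polynomials with $\bar l_i(c_j)=\delta_{ij}$, and set $$b_i=\int_0^1\bar l_i(\eta)\,d\eta,\qquad a_{ij}=\int_0^{c_i}\bar l_j(\eta)\,d\eta,\qquad i,j=1,\dots,s.$$ Assume that $b_i$ and $\bar b_i$ are nonzero, and that the solvability condition holds: the matrix $A_{i\mu}=b_i\dot l_\mu(c_i)$, $i,\mu=1,\dots,s$, is nonsingular. Then the rough Galerkin method with quadrature points $c_i$ and weights $b_i,\bar b_i$ is equivalent to the rough symplectic partitioned Runge–Kutta (RSPRK) method $$Q_{i,k}=q_k+\Delta t\sum_{j=1}^sa_{ij}\frac{\partial H}{\partial p}(Q_{j,k},P_{j,k})+\sum_{j=1}^s\bar a_{ij}\frac{\partial\mathcal{H}}{\partial p}(Q_{j,k},P_{j,k})\cdot Z_{t_k,t_{k+1}},\quad i=1,\dots,s,$$ $$P_{i,k}=p_{k+1}+\Delta t\sum_{j=1}^s\beta_{ij}\frac{\partial H}{\partial q}(Q_{j,k},P_{j,k})+\sum_{j=1}^s\bar\beta_{ij}\frac{\partial\mathcal{H}}{\partial q}(Q_{j,k},P_{j,k})\cdot Z_{t_k,t_{k+1}},\quad i=1,\dots,s,$$ $$q_{k+1}=q_k+\Delta t\sum_{i=1}^sb_i\frac{\partial H}{\partial p}(Q_{i,k},P_{i,k})+\sum_{i=1}^s\bar b_i\frac{\partial\mathcal{H}}{\partial p}(Q_{i,k},P_{i,k})\cdot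 Z_{t_k,t_{k+1}},$$ $$p_k=p_{k+1}+\Delta t\sum_{i=1}^sb_i\frac{\partial H}{\partial q}(Q_{i,k},P_{i,k})+\sum_{i=1}^s\bar b_i\frac{\partial\mathcal{H}}{\partial q}(Q_{i,k},P_{i,k})\cdot Z_{t_k,t_{k+1}},$$ with coefficients $$\bar a_{ij}=\frac{\bar b_ja_{ij}}{b_j},\qquad\beta_{ij}=\frac{b_ja_{ji}}{b_i},\qquad\bar\beta_{ij}=\frac{\bar b_ja_{ji}}{b_i}.$$
   Context: Let $\mathbf{Z}$ be a geometric $\alpha$-Hölder rough path in $\mathbb{R}^K$ over $[t_0,t_1]$, $\alpha\in(\frac13,\frac12]$, with increment $Z_{t_k,t_{k+1}}=Z_{t_{k+1}}-Z_{t_k}\in\mathbb{R}^K$ on a step $[t_k,t_{k+1}]$ of length $\Delta t>0$. $H\in C^\infty(\mathbb{R}^N\times\mathbb{R}^N,\mathbb{R})$, $\mathcal{H}=(H_1,\dots,H_K)^T\in C^\infty(\mathbb{R}^N\times\mathbb{R}^N,\mathbb{R}^K)$; ''$\cdot Z_{t_k,t_{k+1}}$'' is contraction over the $\mathbb{R}^K$ index. Rough Galerkin method (with $r=s$ quadrature points $c_i$ and weights $b_i,\bar b_i$): let $0=d_0<d_1<\dots<d_s=1$, $l_0,\dots,l_s$ the degree-$s$ Lagrange polynomials with $l_\mu(d_\nu)=\delta_{\mu\nu}$, $q_d(t_k+\eta\Delta t)=\sum_{\mu=0}^sq^\mu l_\mu(\eta)$ with $q^0=q_k$, $\dot q_d(t_k+\eta\Delta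 t)=\frac1{\Delta t}\sum_{\mu=0}^sq^\mu\dot l_\mu(\eta)$, $Q_{i,k}=q_d(t_k+c_i\Delta t)$, and stage momenta $P_{i,k}$. The method is the system (derivatives of $H,\mathcal{H}$ at $(Q_{i,k},P_{i,k})$) $$-\Delta t\,b_i\big(\dot q_d(t_k+c_i\Delta t)-\tfrac{\partial H}{\partial p}\big)+\bar b_i\tfrac{\partial\mathcal{H}}{\partial p}\cdot Z_{t_k,t_{k+1}}=0,\quad i=1,\dots,s,$$ $$-\sum_{i=1}^sb_i\big(P_{i,k}\dot l_\mu(c_i)-\Delta t\tfrac{\partial H}{\partial q}l_\mu(c_i)\big)+\sum_{i=1}^s\bar b_i\tfrac{\partial\mathcal{H}}{\partial q}l_\mu(c_i)\cdot Z_{t_k,t_{k+1}}=\begin{cases}p_k,&\mu=0,\\0,&\mu=1,\dots,s-1,\\-p_{k+1},&\mu=s,\end{cases}$$ together with $q_{k+1}=q^s$. ''Equivalent'' means that the two systems are satisfied by the same quantities $q_k,p_k,q_{k+1},p_{k+1},Q_{i,k},P_{i,k}$. *)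

(* Defs.v *)
(* Vectors of R^N are row vectors 'rV[R]_N, and a point (q, p) of R^N x R^N is a
   pair of row vectors. *)
From HB Require Import structures.
From mathcomp Require Import all_boot all_order all_algebra.
From mathcomp Require Import all_classical all_reals all_analysis.

Set Implicit Arguments.
Unset Strict Implicit.
Unset Printing Implicit Defensive.

Import Order.TTheory GRing.Theory Num.Theory.
Import numFieldNormedType.Exports.

Local Open Scope classical_set_scope.
Local Open Scope ring_scope.

Section Smooth.
Context {R : realType} {V W : normedModType R}.

Fixpoint iter_derive (vs : seq V) (f : V -> W) : V -> W :=
  if vs is v :: vs' then 'D_v (iter_derive vs' f) else f.

(* For finite-dimensional V this is the class C^oo: the directions range over
   all of V, in particular over the coordinate vectors. *)
Definition smooth (f : V -> W) : Prop :=
  forall vs : seq V, continuous (iter_derive vs f) /\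
    forall x v, derivable (iter_derive vs f) x v.

End Smooth.

Section RoughPath.
Context {R : realType} {K : nat}.

Definition increment (Z : R -> 'rV[R]_K) (s t : R) : 'rV[R]_K := Z t - Z s.

(* [ZZ s t i j] stands for the iterated integral of (Z^i - Z^i_s) dZ^j over
   [s, t]; only the values with t0 <= s <= t <= t1 matter. *)
Definition holder_rough_path (alpha t0 t1 : R)
    (Z : R -> 'rV[R]_K) (ZZ : R -> R -> 'M[R]_K) : Prop :=
  [/\ forall s u t, t0 <= s -> s <= u -> u <= t -> t <= t1 ->
        ZZ s t - ZZ s u - ZZ u t = (increment Z s u)^T *m increment Z u t,
      exists C, forall s t, t0 <= s -> s <= t -> t <= t1 ->
        `|increment Z s t| <= C * (t - s) `^ alpha
    & exists C, forall s t, t0 <= s -> s <= t -> t <= t1 ->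
        `|ZZ s t| <= C * (t - s) `^ (2 * alpha)].

Definition canonical_lift (z : R -> 'rV[R]_K) (s t : R) : 'M[R]_K :=
  \matrix_(i < K, j < K) \int[lebesgue_measure]_(r in `[s, t])
    (increment z s r 0 i * derive1 (fun u => z u 0 j) r).

(* Geometric rough paths are the limits of canonical lifts of smooth paths in
   the alpha-Hölder rough path metric. *)
Definition geometric_rough_path (alpha t0 t1 : R)
    (Z : R -> 'rV[R]_K) (ZZ : R -> R -> 'M[R]_K) : Prop :=
  holder_rough_path alpha t0 t1 Z ZZ /\
  forall eps, 0 < eps -> exists2 z : R -> 'rV[R]_K, smooth z &
    forall s t, t0 <= s -> s <= t -> t <= t1 ->
      `|increment Z s t - increment z s t| <= eps * (t - s) `^ alpha /\
      `|ZZ s t - canonical_lift z s t| <= eps * (t - s) `^ (2 * alpha).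

End RoughPath.

Section Lagrange.
Context {R : fieldType} {n : nat}.

Definition lagrange_poly (x : 'I_n -> R) (i : 'I_n) : {poly R} :=
  \prod_(j < n | j != i) ((x i - x j)^-1 *: ('X - (x j)%:P)).

Lemma lagrange_poly_sample (x : 'I_n -> R) (i j : 'I_n) :
  injective x -> (lagrange_poly x i).[x j] = (i == j)%:R.
Proof.
move=> xI; rewrite /lagrange_poly horner_prod; have [<-|ij] := eqVneq i j.
  rewrite big1 // => k ki; rewrite hornerZ hornerXsubC mulVf //.
  by rewrite subr_eq0 (inj_eq xI) eq_sym.
by rewrite (bigD1 j) 1?eq_sym //= hornerZ hornerXsubC subrr mulr0 mul0r.
Qed.

Lemma size_lagrange_poly (x : 'I_n -> R) (i : 'I_n) :
  injective x -> size (lagrange_poly x i) = n.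
Proof.
move=> xI; have nz j : j != i -> (x i - x j)^-1 != 0.
  by move=> ji; rewrite invr_eq0 subr_eq0 (inj_eq xI) eq_sym.
rewrite /lagrange_poly size_prod => [|j ji]; last first.
  by rewrite scale_poly_eq0 negb_or nz // polyXsubC_eq0.
rewrite (eq_bigr (fun=> 2)) => [|j ji]; last by rewrite size_scale ?nz // size_XsubC.
rewrite sum_nat_const muln2 -addnn -addSn cardC1 card_ord.
by case: n i {x xI nz} => [[]//|m i] /=; rewrite addnK.
Qed.

End Lagrange.

Section PhaseSpace.
Context {R : realType} {N : nat}.

Definition grad_q (f : 'rV[R]_N * 'rV[R]_N -> R) (x : 'rV[R]_N * 'rV[R]_N) :
    'rV[R]_N :=
  \row_(j < N) 'D_((delta_mx 0 j, 0) : 'rV[R]_N * 'rV[R]_N) f x.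

Definition grad_p (f : 'rV[R]_N * 'rV[R]_N -> R) (x : 'rV[R]_N * 'rV[R]_N) :
    'rV[R]_N :=
  \row_(j < N) 'D_((0, delta_mx 0 j) : 'rV[R]_N * 'rV[R]_N) f x.

Definition grad_q_dot {K : nat} (HH : 'rV[R]_N * 'rV[R]_N -> 'rV[R]_K)
    (x : 'rV[R]_N * 'rV[R]_N) (z : 'rV[R]_K) : 'rV[R]_N :=
  \sum_(k < K) z 0 k *: grad_q (fun y => HH y 0 k) x.

Definition grad_p_dot {K : nat} (HH : 'rV[R]_N * 'rV[R]_N -> 'rV[R]_K)
    (x : 'rV[R]_N * 'rV[R]_N) (z : 'rV[R]_K) : 'rV[R]_N :=
  \sum_(k < K) z 0 k *: grad_p (fun y => HH y 0 k) x.

End PhaseSpace.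

Section Methods.
Context {R : realType} {N K s : nat}.
Implicit Types (q p : 'rV[R]_N) (Q P : 'I_s -> 'rV[R]_N).

(* Polynomial curve on [tk, tk + dt] with value [qs mu] at tk + d mu * dt. *)
Definition qd (d : 'I_s.+1 -> R) (tk dt : R) (qs : 'I_s.+1 -> 'rV[R]_N) (t : R) :
    'rV[R]_N :=
  \sum_(mu < s.+1) (lagrange_poly d mu).[(t - tk) / dt] *: qs mu.

Definition qd_dot (d : 'I_s.+1 -> R) (tk dt : R) (qs : 'I_s.+1 -> 'rV[R]_N)
    (t : R) : 'rV[R]_N :=
  dt^-1 *: \sum_(mu < s.+1) (lagrange_poly d mu)^`().[(t - tk) / dt] *: qs mu.

Lemma is_derive_qd (d : 'I_s.+1 -> R) (tk dt : R) (qs : 'I_s.+1 -> 'rV[R]_N)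
    (t : R) : is_derive t 1 (qd d tk dt qs) (qd_dot d tk dt qs t).
Proof.
have scale (f : R -> R) (df : R) (v : 'rV[R]_N) :
    is_derive t 1 f df -> is_derive t 1 (fun u => f u *: v) (df *: v).
  move=> fd; have fc : (fun h => h^-1 *: (f (h *: 1 + t) - f t)) @ 0^' --> df.
    by rewrite -(@derive_val _ _ _ _ _ _ _ fd); exact: (@ex_derive _ _ _ _ _ _ _ fd).
  have vc : (fun h => h^-1 *: (f (h *: 1 + t) *: v - f t *: v)) @ 0^'
      --> df *: v.
    have -> : (fun h => h^-1 *: (f (h *: 1 + t) *: v - f t *: v)) =
        (fun h => (h^-1 *: (f (h *: 1 + t) - f t)) *: v).
      by apply/funext => h; rewrite -scalerBl scalerA.
    exact: cvgZr_tmp.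
  apply: DeriveDef; first by apply/cvg_ex; exists (df *: v).
  exact: cvg_lim.
rewrite /qd /qd_dot scaler_sumr.
have -> : (fun u => \sum_(mu < s.+1) (lagrange_poly d mu).[(u - tk) / dt] *: qs mu)
    = \sum_(mu < s.+1) (fun u => (lagrange_poly d mu).[(u - tk) / dt] *: qs mu).
  by apply/funext => u; rewrite fct_sumE.
apply: is_derive_sum => mu; rewrite scalerA; apply: scale.
have -> : (fun u => (lagrange_poly d mu).[(u - tk) / dt]) =
    horner (lagrange_poly d mu) \o (fun u => dt^-1 *: (u - tk)).
  by apply/funext => u /=; rewrite [dt^-1 *: _]mulrC.
rewrite mulrC; apply: is_derive1_comp.
  rewrite [dt^-1 *: _]mulrC; exact: is_derive_poly.
have dB : is_derive t 1 (id - cst tk : R -> R) (1 - 0) by exact: is_deriveB.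
have := is_deriveZ dt^-1 dB.
by rewrite subr0 [_ *: 1]mulr1.
Qed.

Definition rough_galerkin (H : 'rV[R]_N * 'rV[R]_N -> R)
    (HH : 'rV[R]_N * 'rV[R]_N -> 'rV[R]_K)
    (c b bbar : 'I_s -> R) (d : 'I_s.+1 -> R) (tk dt : R) (z : 'rV[R]_K)
    qk pk qk1 pk1 Q P : Prop :=
  exists qs : 'I_s.+1 -> 'rV[R]_N,
  [/\ qs ord0 = qk,
      forall i, Q i = qd d tk dt qs (tk + c i * dt),
      forall i,
        - ((dt * b i) *: (qd_dot d tk dt qs (tk + c i * dt)
                          - grad_p H (Q i, P i)))
        + bbar i *: grad_p_dot HH (Q i, P i) z = 0,
      forall mu : 'I_s.+1,
        - (\sum_(i < s) b i *:
             ((lagrange_poly d mu)^`().[c i] *: P i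
              - (dt * (lagrange_poly d mu).[c i]) *: grad_q H (Q i, P i)))
        + \sum_(i < s) (bbar i * (lagrange_poly d mu).[c i]) *:
             grad_q_dot HH (Q i, P i) z
        = if mu == ord0 then pk else if mu == ord_max then - pk1 else 0
    & qk1 = qs ord_max].

Definition rsprk (H : 'rV[R]_N * 'rV[R]_N -> R)
    (HH : 'rV[R]_N * 'rV[R]_N -> 'rV[R]_K)
    (a abar beta betabar : 'I_s -> 'I_s -> R) (b bbar : 'I_s -> R)
    (dt : R) (z : 'rV[R]_K) qk pk qk1 pk1 Q P : Prop :=
  [/\ forall i, Q i = qk + dt *: (\sum_(j < s) a i j *: grad_p H (Q j, P j))
                + \sum_(j < s) abar i j *: grad_p_dot HH (Q j, P j) z,
      forall i, P i = pk1 + dt *: (\sum_(j < s) beta i j *: grad_q H (Q j, P j))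
                + \sum_(j < s) betabar i j *: grad_q_dot HH (Q j, P j) z,
      qk1 = qk + dt *: (\sum_(i < s) b i *: grad_p H (Q i, P i))
            + \sum_(i < s) bbar i *: grad_p_dot HH (Q i, P i) z
    & pk = pk1 + dt *: (\sum_(i < s) b i *: grad_q H (Q i, P i))
            + \sum_(i < s) bbar i *: grad_q_dot HH (Q i, P i) z].

End Methods.

(* Main.v *)
Require Import Defs.
From HB Require Import structures.
From mathcomp Require Import all_boot all_order all_algebra.
From mathcomp Require Import all_classical all_reals all_analysis.
From mathcomp Require Import ring.
Set Implicit Arguments.
Unset Strict Implicit.
Unset Printing Implicit Defensive.
Import Order.TTheory GRing.Theory Num.Theory.
Import numFieldNormedType.Exports.
Local Open Scope classical_set_scope.
Local Open Scope ring_scope.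

(** Write [l_mu] for the Lagrange polynomials at the nodes [d] and [B_j] for the
antiderivatives, vanishing at 0, of the Lagrange polynomials at the quadrature
points [c], so that [a i j = B_j (c i)] and [b j = B_j 1].  A polynomial of
degree at most [s] is determined by its value at 0 and by its derivatives at
the [s] points [c j]:
   [L x = L 0 + \sum_j L' (c j) * B_j x]     ([horner_nodal_derivatives]).
Everything else is linear algebra on top of this identity.  It is convenient to
merge drift and noise into the single vectors
   [v_i = dt * dH/dp + (bbar_i / b_i) * dHH/dp . z],
   [w_i = dt * dH/dq + (bbar_i / b_i) * dHH/dq . z],
because [abar], [betabar] and [bbar] arise from [a], [beta] and [b] by the
factor [bbar_j / b_j] ([drift_noise_sum]).

Positions.  The first Galerkin equation says that the curve has slope [v_i] at
each [c i].  By the identity applied to the curve, this amounts to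
[Q_i = qk + \sum_j a i j v_j] and [qk1 = qk + \sum_j b j v_j]
([curve_from_slopes], [node_from_slopes]).  Conversely the curve
[qk + \sum_j B_j v_j] has degree at most [s], so it is represented by its values
at the nodes [d] ([curve_with_slopes]).

Momenta.  Let [F_j = P_j - pk1 - \sum_i (b_i a i j / b_j) w_i] be the defect of
the Runge-Kutta momentum stages.  Applying the identity to [l_mu] at the points
[c i] and at 1 turns the defect of the [mu]-th Galerkin equation into
   [- \sum_j b_j l_mu' (c j) F_j]
plus, for [mu = 0] only, the defect of the equation for [pk]
([momentum_residual]).  So the Runge-Kutta equations imply the Galerkin ones;
conversely the equations with [mu >= 1] form a linear system for the [F_j] whose
matrix is the transpose of the solvability matrix, hence [F = 0], and the
equation with [mu = 0] then gives [pk] ([momentum_equations]). *)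

(** * Lagrange interpolation and antiderivatives *)

(** The difference of the two sides has degree less than [n] and vanishes at the
[n] distinct points [x i]. *)
Lemma lagrange_interpolation (F : fieldType) (n : nat) (x : 'I_n -> F)
    (p : {poly F}) :
  injective x -> (size p <= n)%N ->
  p = \sum_(i < n) p.[x i] *: lagrange_poly x i.
Proof.
move=> xI sp; apply/eqP; rewrite -subr_eq0; apply/eqP.
apply: (@roots_geq_poly_eq0 _ _ [seq x i | i <- enum 'I_n]).
- apply/allP => _ /mapP[j _ ->]; rewrite rootE hornerD hornerN horner_sum.
  rewrite (bigD1 j) //= hornerZ lagrange_poly_sample // eqxx mulr1.
  rewrite big1 ?addr0 ?subrr // => i /negPf ij.
  by rewrite hornerZ lagrange_poly_sample // ij mulr0.
- by rewrite (map_inj_uniq xI) enum_uniq.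
- rewrite size_map size_enum_ord (leq_trans (size_polyD _ _)) // size_polyN.
  rewrite geq_max sp (leq_trans (size_sum _ _ _)) //; apply/bigmax_leqP => i _.
  by rewrite (leq_trans (size_scale_leq _ _)) // size_lagrange_poly.
Qed.

Section Antiderivative.
Context {R : numFieldType}.

(** The primitive vanishing at 0: the spurious coefficient [p`_0 / 0] at
[i = 0] is 0, division by zero being zero. *)
Definition antideriv (p : {poly R}) : {poly R} :=
  \poly_(i < (size p).+1) (p`_i.-1 / i%:R).

Lemma size_antideriv (p : {poly R}) : (size (antideriv p) <= (size p).+1)%N.
Proof. exact: size_poly. Qed.

Lemma antideriv0 (p : {poly R}) : (antideriv p).[0] = 0.
Proof. by rewrite horner_coef0 coef_poly /= invr0 mulr0. Qed.

Lemma deriv_antideriv (p : {poly R}) : (antideriv p)^`() = p.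
Proof.
apply/polyP => i; rewrite coef_deriv coef_poly /= ltnS.
case: ltnP => [_|/leq_sizeP/(_ i (leqnn _)) ->]; last by rewrite mul0rn.
by rewrite -[LHS]mulr_natr divfK // pnatr_eq0.
Qed.

Lemma deriv_eq0_const (p : {poly R}) : p^`() = 0 -> p = (p.[0])%:P.
Proof.
move=> p'0; apply/polyP => -[|i]; rewrite coefC /= ?horner_coef0 //.
have := coef_deriv p i; rewrite p'0 coef0 => /esym/eqP.
by rewrite mulrn_eq0 /= => /eqP.
Qed.

(** The derivative of [p] has degree less than [n], hence is interpolated by its
values at the [c j]; so [p] and the combination of antiderivatives on the right
have the same derivative and differ by the constant [p.[0]]. *)
Lemma horner_nodal_derivatives (n : nat) (c : 'I_n -> R) (p : {poly R}) (x : R) :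
  injective c -> (size p <= n.+1)%N ->
  p.[x] = p.[0] + \sum_(j < n) p^`().[c j] * (antideriv (lagrange_poly c j)).[x].
Proof.
move=> cI sp.
pose r := p - \sum_(j < n) p^`().[c j] *: antideriv (lagrange_poly c j).
have r'0 : r^`() = 0.
  rewrite /r derivB raddf_sum /=; apply/eqP; rewrite subr_eq0; apply/eqP.
  under eq_bigr do rewrite derivZ deriv_antideriv.
  apply: lagrange_interpolation => //.
  have [->|p0] := eqVneq p 0; first by rewrite deriv0 size_poly0.
  by rewrite -ltnS (leq_trans (lt_size_deriv p0)).
have r0 y : r.[y] = p.[y]
    - \sum_(j < n) p^`().[c j] * (antideriv (lagrange_poly c j)).[y].
  by rewrite hornerD hornerN horner_sum; under eq_bigr do rewrite hornerZ.
have : r.[x] = r.[0] by rewrite (deriv_eq0_const r'0) !hornerC.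
rewrite !r0 [X in _ = p.[0] - X]big1 => [|j _]; last by rewrite antideriv0 mulr0.
by rewrite subr0 => /eqP; rewrite subr_eq => /eqP.
Qed.

End Antiderivative.

Lemma Rintegral_antideriv (R : realType) (p : {poly R}) (x : R) : 0 <= x ->
  \int[lebesgue_measure]_(t in `[0, x]) p.[t] = (antideriv p).[x].
Proof.
rewrite le_eqVlt => /predU1P[<-|x0].
  by rewrite set_itv1 Rintegral_set1 antideriv0.
have dA (t : R) : is_derive t 1 (horner (antideriv p)) p.[t].
  by rewrite -{2}(deriv_antideriv p); exact: is_derive_poly.
have cP (q : {poly R}) (t : R) : {for t, continuous (horner q)}.
  by apply/differentiable_continuous/derivable1_diffP.
rewrite /Rintegral (@continuous_FTC2 _ (horner p) (horner (antideriv p))) //.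
- by rewrite antideriv0 sube0.
- by apply: continuous_in_subspaceT => t _; exact: cP.
- split => [t _| |]; first exact: ex_derive.
  + exact/cvg_at_right_filter/cP.
  + exact/cvg_at_left_filter/cP.
- by move=> t _; rewrite derive1E derive_val.
Qed.

(** * Curves with prescribed slopes at the quadrature points *)

Section Collocation.
Context {R : realType} {V : lmodType R} {s : nat}.
Variables (c : 'I_s -> R) (d : 'I_s.+1 -> R).
Hypotheses (cI : injective c) (dI : injective d) (d0 : d ord0 = 0).

Let l := lagrange_poly d.
Let B j := antideriv (lagrange_poly c j).

Lemma nodal_polynomial_slopes (mu : 'I_s.+1) (x : R) :
  (l mu).[x] = (mu == ord0)%:R + \sum_(j < s) (l mu)^`().[c j] * (B j).[x].
Proof.
rewrite (horner_nodal_derivatives _ cI) ?size_lagrange_poly //.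
by rewrite -d0 lagrange_poly_sample.
Qed.

(** A curve of degree at most [s] is its initial value plus the integral of its
velocity, which is interpolated by the slopes at the [c j]. *)
Lemma curve_from_slopes (qs : 'I_s.+1 -> V) (x : R) :
  \sum_mu (l mu).[x] *: qs mu =
  qs ord0 + \sum_(j < s) (B j).[x] *: \sum_mu (l mu)^`().[c j] *: qs mu.
Proof.
under eq_bigr do rewrite nodal_polynomial_slopes scalerDl scaler_suml.
rewrite big_split /=; congr (_ + _).
  rewrite (bigD1 ord0) //= ?eqxx scale1r big1 ?addr0 // => mu /negPf ->.
  by rewrite scale0r.
rewrite exchange_big; apply: eq_bigr => j _; rewrite scaler_sumr.
by apply: eq_bigr => mu _; rewrite scalerA mulrC.
Qed.

Lemma node_from_slopes (qs : 'I_s.+1 -> V) (nu : 'I_s.+1) :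
  qs nu =
  qs ord0 + \sum_(j < s) (B j).[d nu] *: \sum_mu (l mu)^`().[c j] *: qs mu.
Proof.
rewrite -curve_from_slopes (bigD1 nu) //= lagrange_poly_sample // eqxx scale1r.
rewrite big1 ?addr0 // => mu /negPf ne.
by rewrite lagrange_poly_sample // ne scale0r.
Qed.

(** The nodal values of [q + \sum_j B_j v_j] do it: this curve has degree at most
[s], so interpolation at the [s + 1] nodes [d] reproduces it, slopes included. *)
Lemma curve_with_slopes (q : V) (v : 'I_s -> V) :
  exists2 qs : 'I_s.+1 -> V, qs ord0 = q &
    forall i, \sum_mu (l mu)^`().[c i] *: qs mu = v i.
Proof.
exists (fun mu => q + \sum_(j < s) (B j).[d mu] *: v j).
  by rewrite d0 big1 ?addr0 // => j _; rewrite antideriv0 scale0r.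
move=> i.
have deriv_interp (p : {poly R}) : (size p <= s.+1)%N ->
    \sum_mu (l mu)^`().[c i] * p.[d mu] = p^`().[c i].
  move=> sp; rewrite [in RHS](lagrange_interpolation dI sp) raddf_sum horner_sum /=.
  by apply: eq_bigr => mu _; rewrite derivZ hornerZ mulrC.
have sum_l' : \sum_mu (l mu)^`().[c i] = 0.
  have := deriv_interp 1%:P; rewrite size_polyC oner_eq0 derivC horner0.
  by move=> /(_ isT) e; rewrite -[RHS]e; apply: eq_bigr => mu _; rewrite hornerC mulr1.
under eq_bigr do rewrite scalerDr scaler_sumr.
rewrite big_split /= -scaler_suml sum_l' scale0r add0r exchange_big /=.
rewrite (bigD1 i) //= [X in _ + X]big1 ?addr0 => [|j ji];
  under eq_bigr do rewrite scalerA; rewrite -scaler_suml deriv_interp;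
  rewrite ?(leq_trans (size_antideriv _)) ?size_lagrange_poly //;
  rewrite deriv_antideriv lagrange_poly_sample //.
- by rewrite eqxx scale1r.
- by rewrite (negPf ji) scale0r.
Qed.

End Collocation.

(** * The momentum equations *)

Section Momentum.
Context {R : realType} {N s : nat}.
Variables (c : 'I_s -> R) (d : 'I_s.+1 -> R) (b : 'I_s -> R).
Variables (a : 'I_s -> 'I_s -> R).
Hypotheses (cI : injective c) (dI : injective d).
Hypotheses (d0 : d ord0 = 0) (d1 : d ord_max = 1).
Hypothesis aE : forall i j, a i j = (antideriv (lagrange_poly c j)).[c i].
Hypothesis bE : forall j, b j = (antideriv (lagrange_poly c j)).[1].
Hypothesis b0 : forall i, b i != 0.
Variables (p p1 : 'rV[R]_N) (P w : 'I_s -> 'rV[R]_N).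

Let l := lagrange_poly d.
Let F j := P j - p1 - \sum_(i < s) (b i * a i j / b j) *: w i.

(** Substituting [l_mu (c i) = delta_(mu,0) + \sum_j l_mu' (c j) a i j] in the
force term and [delta_(mu,s) = l_mu 1 = delta_(mu,0) + \sum_j b_j l_mu' (c j)] in
the boundary term leaves a combination of the stage defects [F j]. *)
Lemma momentum_residual (mu : 'I_s.+1) :
  - \sum_(i < s) b i *: ((l mu)^`().[c i] *: P i - (l mu).[c i] *: w i)
  - ((mu == ord0)%:R *: p - (mu == ord_max)%:R *: p1) =
  - \sum_(j < s) (b j * (l mu)^`().[c j]) *: F j
  + (mu == ord0)%:R *: (p1 + \sum_(i < s) b i *: w i - p).
Proof.
have max_l : (mu == ord_max)%:R =
    (mu == ord0)%:R + \sum_(j < s) b j * (l mu)^`().[c j].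
  rewrite -[LHS](lagrange_poly_sample mu ord_max dI) d1.
  rewrite (nodal_polynomial_slopes cI dI d0); congr (_ + _).
  by apply: eq_bigr => j _; rewrite -bE mulrC.
have force : \sum_(i < s) b i *: ((l mu).[c i] *: w i) =
    (mu == ord0)%:R *: (\sum_(i < s) b i *: w i)
    + \sum_(j < s) (b j * (l mu)^`().[c j]) *:
        \sum_(i < s) (b i * a i j / b j) *: w i.
  rewrite scaler_sumr; under [X in _ + X]eq_bigr do rewrite scaler_sumr.
  rewrite exchange_big -big_split /=; apply: eq_bigr => i _.
  rewrite /l (nodal_polynomial_slopes cI dI d0) -/l.
  under [X in _ = _ + X]eq_bigr do rewrite scalerA.
  rewrite -scaler_suml !scalerA -scalerDl; congr (_ *: _).
  rewrite mulrDr mulr_sumr mulrC; congr (_ + _); apply: eq_bigr => j _.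
  rewrite -aE; field; exact: b0.
under [in LHS]eq_bigr do rewrite scalerBr scalerA.
rewrite sumrB force max_l.
under [in RHS]eq_bigr do rewrite /F !scalerBr.
rewrite !sumrB -scaler_suml !scalerBr !scalerDr !scalerDl.
(* The sums become atoms of an identity checked entry by entry. *)
set S1 := \sum_(i < s) _ *: P i.
set S2 := \sum_(i < s) _ *: \sum_(_ < s) _.
set S3 := (\sum_(_ < s) _) *: p1.
set S4 := _ *: (\sum_(_ < s) _); set S5 := _ *: p; set S6 := _ *: p1.
clearbody S1 S2 S3 S4 S5 S6.
apply/rowP => k; rewrite !mxE; ring.
Qed.

(** By [momentum_residual] the equations with [mu >= 1] read [A^T F = 0] for the
solvability matrix [A]; once [F = 0], only the equation for [p] is left. *)
Lemma momentum_equations :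
  \matrix_(i < s, mu < s) (b i * (l (lift ord0 mu))^`().[c i]) \in unitmx ->
  (forall mu : 'I_s.+1,
    - \sum_(i < s) b i *: ((l mu)^`().[c i] *: P i - (l mu).[c i] *: w i) =
    (mu == ord0)%:R *: p - (mu == ord_max)%:R *: p1) <->
  (forall j, P j = p1 + \sum_(i < s) (b i * a i j / b j) *: w i) /\
  p = p1 + \sum_(i < s) b i *: w i.
Proof.
move=> uA; split=> [G|[PE pE] mu].
  have res mu : \sum_(j < s) (b j * (l mu)^`().[c j]) *: F j =
      (mu == ord0)%:R *: (p1 + \sum_(i < s) b i *: w i - p).
    have := momentum_residual mu; rewrite G subrr addrC.
    by move=> /esym/eqP; rewrite subr_eq0 => /eqP.
  have F0 j : F j = 0.
    set A := matrix_of_fun _ _ in uA.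
    have : A^T *m \matrix_i F i = 0.
      apply/row_matrixP => mu; rewrite row0 row_mul mulmx_sum_row.
      (* The index lift ord0 mu is nonzero, so the boundary term of res has
         coefficient 0 by computation. *)
      rewrite -[RHS](scale0r (p1 + \sum_(i < s) b i *: w i - p)).
      rewrite -[RHS](res (lift ord0 mu)).
      by apply: eq_bigr => i _; rewrite !mxE rowK.
    move=> /(congr1 (mulmx (invmx A^T))); rewrite mulKmx ?unitmx_tr // mulmx0.
    by move=> /(congr1 (row j)); rewrite rowK row0.
  split=> [j|].
    by apply/eqP; rewrite -subr_eq0 opprD addrA; exact/eqP/F0.
  apply/esym/eqP; rewrite -subr_eq0; have := res ord0.
  rewrite eqxx scale1r => <-; apply/eqP.
  by rewrite big1 // => j _; rewrite F0 scaler0.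
apply/eqP; rewrite -subr_eq0 momentum_residual -pE subrr scaler0 addr0 oppr_eq0.
rewrite big1 // => j _; rewrite /F {1}PE (addrAC p1) subrr add0r subrr.
by rewrite scaler0.
Qed.

End Momentum.

(** * Equivalence of the two methods *)

(** Lets the drift and noise sums of either method be treated as one sum with a
single set of coefficients. *)
Lemma drift_noise_sum (R : comPzRingType) (V : lmodType R) (s : nat) (dt : R)
    (f fbar rho : 'I_s -> R) (x y : 'I_s -> V) :
  (forall j, fbar j = f j * rho j) ->
  dt *: (\sum_(j < s) f j *: x j) + \sum_(j < s) fbar j *: y j =
  \sum_(j < s) f j *: (dt *: x j + rho j *: y j).
Proof.
move=> fE; rewrite scaler_sumr -big_split; apply: eq_bigr => j _ /=.
by rewrite fE scalerDr !scalerA [dt * _]mulrC.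
Qed.

Theorem mainTheorem13 (R : realType) (N K s : nat)
    (alpha t0 t1 : R) (Z : R -> 'rV[R]_K) (ZZ : R -> R -> 'M[R]_K)
    (H : 'rV[R]_N * 'rV[R]_N -> R) (HH : 'rV[R]_N * 'rV[R]_N -> 'rV[R]_K)
    (tk dt : R) (c b bbar : 'I_s -> R) (d : 'I_s.+1 -> R)
    (a abar beta betabar : 'I_s -> 'I_s -> R)
    (halpha : 3^-1 < alpha <= 2^-1)
    (hZ : geometric_rough_path alpha t0 t1 Z ZZ)
    (hH : smooth H) (hHH : smooth HH)
    (hdt : 0 < dt) (htk : t0 <= tk) (htk1 : tk + dt <= t1)
    (hd : forall mu nu : 'I_s.+1, (mu < nu)%N -> d mu < d nu)
    (hd0 : d ord0 = 0) (hd1 : d ord_max = 1)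
    (hc : forall i, 0 <= c i <= 1) (hcI : injective c)
    (hb : forall i, b i =
      \int[lebesgue_measure]_(eta in `[0, 1]) (lagrange_poly c i).[eta])
    (ha : forall i j, a i j =
      \int[lebesgue_measure]_(eta in `[0, c i]) (lagrange_poly c j).[eta])
    (hb0 : forall i, b i != 0) (hbbar0 : forall i, bbar i != 0)
    (hA : \matrix_(i < s, mu < s)
            (b i * (lagrange_poly d (lift ord0 mu))^`().[c i]) \in unitmx)
    (habar : forall i j, abar i j = bbar j * a i j / b j)
    (hbeta : forall i j, beta i j = b j * a j i / b i)
    (hbetabar : forall i j, betabar i j = bbar j * a j i / b i)
    (qk pk qk1 pk1 : 'rV[R]_N) (Q P : 'I_s -> 'rV[R]_N) :
  rough_galerkin H HH c b bbar d tk dt (increment Z tk (tk + dt))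
    qk pk qk1 pk1 Q P
  <-> rsprk H HH a abar beta betabar b bbar dt (increment Z tk (tk + dt))
        qk pk qk1 pk1 Q P.
Proof.
have dI : injective d.
  move=> i j dij; apply/val_inj; case: (ltngtP i j) => // ij;
    by have := hd _ _ ij; rewrite dij ltxx.
have aE i j : a i j = (antideriv (lagrange_poly c j)).[c i].
  by rewrite ha Rintegral_antideriv //; case/andP: (hc i).
have bE j : b j = (antideriv (lagrange_poly c j)).[1].
  by rewrite hb Rintegral_antideriv.
have dt0 : dt != 0 by rewrite gt_eqF.
have tE x : (tk + x * dt - tk) / dt = x by rewrite addrAC subrr add0r mulfK.
set z := increment Z tk (tk + dt).
pose rho i := bbar i / b i.
pose v i := dt *: grad_p H (Q i, P i) + rho i *: grad_p_dot HH (Q i, P i) z.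
pose w i := dt *: grad_q H (Q i, P i) + rho i *: grad_q_dot HH (Q i, P i) z.
have rhoE i : bbar i = b i * rho i by rewrite /rho mulrC divfK.
have abarE i j : abar i j = a i j * rho j by rewrite habar /rho; field.
have betabarE i j : betabar i j = beta i j * rho j.
  by rewrite hbetabar hbeta /rho; field; rewrite !hb0.
(* The position equations are b_i times a slope defect, and b_i is nonzero. *)
have slopeE qs i :
    - ((dt * b i) *: (qd_dot d tk dt qs (tk + c i * dt) - grad_p H (Q i, P i)))
    + bbar i *: grad_p_dot HH (Q i, P i) z =
    b i *: (v i - \sum_mu (lagrange_poly d mu)^`().[c i] *: qs mu).
  rewrite /qd_dot tE rhoE; set S := \sum_(mu < _) _.
  rewrite /v; apply/rowP => k; rewrite !mxE; field; exact: dt0.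
(* The nodes 0 and 1 are distinct, so the cases mu = 0 and mu = s are disjoint. *)
have ord0_neq_max : (ord0 == ord_max :> 'I_s.+1) = false.
  apply/negbTE/eqP => e; have := hd1; rewrite -e hd0 => /eqP.
  by rewrite eq_sym oner_eq0.
have momE (mu : 'I_s.+1) :
    (- (\sum_(i < s) b i *:
         ((lagrange_poly d mu)^`().[c i] *: P i
          - (dt * (lagrange_poly d mu).[c i]) *: grad_q H (Q i, P i)))
    + \sum_(i < s) (bbar i * (lagrange_poly d mu).[c i]) *:
         grad_q_dot HH (Q i, P i) z
    = if mu == ord0 then pk else if mu == ord_max then - pk1 else 0) <->
    (- \sum_(i < s) b i *: ((lagrange_poly d mu)^`().[c i] *: P i
                            - (lagrange_poly d mu).[c i] *: w i) =
    (mu == ord0)%:R *: pk - (mu == ord_max)%:R *: pk1).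
  rewrite -!sumrN -big_split /=.
  under eq_bigr => i _.
    have -> : - (b i *: ((lagrange_poly d mu)^`().[c i] *: P i
                - (dt * (lagrange_poly d mu).[c i]) *: grad_q H (Q i, P i)))
        + (bbar i * (lagrange_poly d mu).[c i]) *: grad_q_dot HH (Q i, P i) z
        = - (b i *: ((lagrange_poly d mu)^`().[c i] *: P i
                            - (lagrange_poly d mu).[c i] *: w i)).
      by rewrite rhoE /w; apply/rowP => k; rewrite !mxE; ring.
    over.
  suff -> : (if mu == ord0 then pk else if mu == ord_max then - pk1 else 0) =
    (mu == ord0)%:R *: pk - (mu == ord_max)%:R *: pk1 by [].
  have [->|_] := eqVneq mu ord0; first by rewrite ord0_neq_max scale1r scale0r subr0.
  by rewrite scale0r sub0r; case: eqP; rewrite ?scale1r ?scale0r ?oppr0.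
have bmom : (forall i, P i = pk1 +
      \sum_(j < s) beta i j *: w j) <->
    (forall j, P j = pk1 + \sum_(i < s) (b i * a i j / b j) *: w i).
  by split=> PE i; rewrite {1}PE; congr (_ + _); apply: eq_bigr => j _;
    rewrite hbeta.
have momM := @momentum_equations R N s c d b a hcI dI hd0 hd1 aE bE hb0
  pk pk1 P w hA.
split=> [[qs [q0 QE vE pE q1]]|[QE PE q1E p0E]].
- have slope i : \sum_mu (lagrange_poly d mu)^`().[c i] *: qs mu = v i.
    have /eqP := vE i; rewrite slopeE scaler_eq0 (negPf (hb0 i)) subr_eq0.
    by move=> /eqP.
  have [PE p0E] := momM.1 (fun mu => (momE mu).1 (pE mu)).
  split=> [i|i||].
  + rewrite -addrA (drift_noise_sum _ _ _ (abarE i)) QE /qd tE.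
    rewrite (curve_from_slopes hcI dI hd0) q0; congr (_ + _).
    by apply: eq_bigr => j _; rewrite slope -aE.
  + by rewrite -addrA (drift_noise_sum _ _ _ (betabarE i)); exact: bmom.2.
  + rewrite -addrA (drift_noise_sum _ _ _ rhoE) q1 -q0.
    rewrite (node_from_slopes hcI dI hd0 qs ord_max); congr (_ + _).
    by apply: eq_bigr => j _; rewrite slope hd1 -bE.
  + by rewrite -addrA (drift_noise_sum _ _ _ rhoE).
- have [qs q0 slope] := curve_with_slopes hcI dI hd0 qk v.
  exists qs; split=> [//|i|i|mu|].
  + rewrite QE /qd tE (curve_from_slopes hcI dI hd0) q0.
    rewrite -addrA (drift_noise_sum _ _ _ (abarE i)); congr (_ + _).
    by apply: eq_bigr => j _; rewrite slope -aE.
  + by rewrite slopeE slope subrr scaler0.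
  + apply/momE; move: mu; apply/momM; split; last first.
      by rewrite {1}p0E -addrA (drift_noise_sum _ _ _ rhoE).
    apply/bmom => i; rewrite {1}PE -addrA.
    by rewrite (drift_noise_sum _ _ _ (betabarE i)).
  + rewrite (node_from_slopes hcI dI hd0 qs ord_max) q0 q1E -addrA.
    rewrite (drift_noise_sum _ _ _ rhoE); congr (_ + _).
    by apply: eq_bigr => j _; rewrite slope hd1 -bE.
Qed.
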